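(* Let $J\ge p\ge 1$ be integers, let $\sigma_\varepsilon^2>0$, let $\mathbf{\Sigma}_\gamma$ be a nonnegative definite symmetric $J\times J$ matrix, let $I>0$, and let $\mathbf{A}_{\bm\beta}$ be a real $J\times p$ matrix (the Jacobian of the mean response at a fixed nominal parameter $\bm\beta$). For an approximate design $\xi=(I_1,\dots,I_J)$ (real $I_j\ge 0$ with $\sum_j I_j=I$) put $\mathbf{M}_0(\xi)=\mathrm{diag}(I_1,\dots,I_J)$, $\mathbf{M}_0(\xi)^{1/2}=\mathrm{diag}(\sqrt{I_1},\dots,\sqrt{I_J})$ and $$\mathbf{M}_{\bm\beta}(\xi)=\mathbf{A}_{\bm\beta}^{\mathrm T}\mathbf{M}_0(\xi)^{1/2}\big(\sigma_\varepsilon^2\mathbf{I}_J+\mathbf{M}_0(\xi)^{1/2}\mathbf{\Sigma}_\gamma\mathbf{M}_0(\xi)^{1/2}\big)^{-1}\mathbf{M}_0(\xi)^{1/2}\mathbf{A}_{\bm\beta}.$$ Let $\xi^*=(I_1^*,\dots,I_J^* )$ be a design under which $\bm\beta$ is estimable. For a design $\xi$ under which $\bm\beta$ is estimable, let $\psi_j(\xi)$ denote the $j$th diagonal entry of the $J\times J$ matrix $$\big(\sigma_\varepsilon^2\mathbf{I}_J+\mathbf{\Sigma}_\gamma\mathbf{M}_0(\xi)\big)^{-1}\mathbf{A}_{\bm\beta}\,\mathbf{M}_{\bm\beta}(\xi)^{-1}\mathbf{A}_{\bm\beta}^{\mathrm T}\big(\sigma_\varepsilon^2\mathbf{I}_J+\mathbf{M}_0(\xi)\mathbf{\Sigma}_\gamma\big)^{-1}.$$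 Then $\xi^*$ is locally $D$-optimal if and only if $$\psi_j(\xi^* )\le \frac{1}{I}\sum_{\ell=1}^J I_\ell^*\,\psi_\ell(\xi^* )\quad\text{for all } j=1,\dots,J.$$ Moreover, for the optimal design $\xi^*$, equality holds in this inequality for every $j$ with $I_j^*>0$.
   Context: Setting: $N$ subjects are tested at $J$ fixed time points $t_j=j-1$; the mean response at time $t_j$ is $\mu_j(\bm\beta)$ with parameter $\bm\beta\in\mathbb{R}^p$, and $\mathbf{A}_{\bm\beta}=(\partial\mu_j(\bm\beta)/\partial\beta_k)_{j,k}$ is its $J\times p$ Jacobian; random subject effects at the $J$ time points have covariance $\mathbf{\Sigma}_\gamma$ and measurement errors have variance $\sigma_\varepsilon^2$. A design $\xi=(I_1,\dots,I_J)$ specifies how many items $I_j$ are administered at time $t_j$, with total $I$; for approximate designs the $I_j$ are nonnegative reals. $\mathbf{M}_{\bm\beta}(\xi)$ above is the standardized (per subject) Fisher information. The parameter $\bm\beta$ is estimable under $\xi$ if $\mathbf{A}_{\bm\beta}$ has full column rank $p$ and its columns lie in the column space of $\mathbf{M}_0(\xi)$. A design $\xi^*$ is locally $D$-optimal (at the given $\bm\beta$) if $\log\det\mathbf{M}_{\bm\beta}(\xi^* )\ge\log\det\mathbf{M}_{\bm\beta}(\xi)$ for all approximate designs $\xi$ with total $I$ under which $\bm\beta$ is estimable. *)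

(* Defs.v *)
From HB Require Import structures.
From mathcomp Require Import all_boot all_order all_algebra.
From mathcomp Require Import all_classical all_reals all_analysis.
Set Implicit Arguments. Unset Strict Implicit. Unset Printing Implicit Defensive.
Import Order.TTheory GRing.Theory Num.Theory.
Local Open Scope ring_scope.

Section Design.
Variables (R : realType) (J p : nat).

Definition is_design (I : R) (xi : 'rV[R]_J) : Prop :=
  (forall j, 0 <= xi 0 j) /\ \sum_(j < J) xi 0 j = I.

Definition M0 (xi : 'rV[R]_J) : 'M[R]_J := diag_mx xi.
Definition M0sqrt (xi : 'rV[R]_J) : 'M[R]_J := diag_mx (map_mx Num.sqrt xi).

Definition Mbeta (s2 : R) (Sg : 'M[R]_J) (A : 'M[R]_(J, p)) (xi : 'rV[R]_J)
  : 'M[R]_p :=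
  A^T *m M0sqrt xi *m invmx (s2%:M + M0sqrt xi *m Sg *m M0sqrt xi)
      *m M0sqrt xi *m A.

(* beta estimable under xi: A has full column rank p and the columns of A
   lie in the column space of M_0(xi) (i.e. rows of A^T in the row space of
   M_0(xi)^T = M_0(xi)). *)
Definition estimable (A : 'M[R]_(J, p)) (xi : 'rV[R]_J) : Prop :=
  \rank A = p /\ (A^T <= (M0 xi)^T)%MS.

Definition psi (s2 : R) (Sg : 'M[R]_J) (A : 'M[R]_(J, p)) (xi : 'rV[R]_J)
  (j : 'I_J) : R :=
  (invmx (s2%:M + Sg *m M0 xi) *m A *m invmx (Mbeta s2 Sg A xi) *m A^T
     *m invmx (s2%:M + M0 xi *m Sg)) j j.

Definition locally_D_optimal (I s2 : R) (Sg : 'M[R]_J) (A : 'M[R]_(J, p))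
  (xis : 'rV[R]_J) : Prop :=
  forall xi : 'rV[R]_J, is_design I xi -> estimable A xi ->
    ln (\det (Mbeta s2 Sg A xi)) <= ln (\det (Mbeta s2 Sg A xis)).

End Design.

(* Main.v *)
(* With W = (s2 + Sg D)^-1 A, D = M0 xi, the information matrix is
   M(xi) = s2 W^T D W + W^T D Sg D W; it is matrix-concave in xi, with tangent
   M(xi) + s2 W^T (D' - D) W at xi. Combined with
   ln det F <= ln det E + tr (E^-1 F) - p for positive definite E and F, this gives
     ln det M(xi') <= ln det M(xi) + s2 sum_j (xi'_j - xi_j) psi_j(xi),
   from which the psi condition is sufficient. For necessity no derivative is
   needed: the same inequality based at the mixture (1-e) xis + e I delta_k and
   evaluated at xi' = xis yields the condition at the mixture, and e tends to 0. *)
Require Import Defs.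
From HB Require Import structures.
From mathcomp Require Import all_boot all_order all_algebra.
From mathcomp Require Import all_classical all_reals all_analysis.
From mathcomp Require Import ring lra.
Set Implicit Arguments. Unset Strict Implicit. Unset Printing Implicit Defensive.
Import Order.TTheory GRing.Theory Num.Theory.
Import numFieldNormedType.Exports.
Local Open Scope ring_scope.

(** * Quadratic forms and definite matrices *)

Definition possemidef (R : realType) (n : nat) (E : 'M[R]_n) : Prop :=
  forall v : 'cV[R]_n, 0 <= (v^T *m E *m v) 0 0.

(** Unlike [possemidef], symmetry is included: the elimination of the first row and column below
    relies on it. *)
Definition posdef (R : realType) (n : nat) (E : 'M[R]_n) : Prop :=
  E^T = E /\ forall v : 'cV[R]_n, v != 0 -> 0 < (v^T *m E *m v) 0 0.

Lemma unitmx_ker0 (R : realType) (n : nat) (E : 'M[R]_n) :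
  (forall v : 'cV[R]_n, E *m v = 0 -> v = 0) -> E \in unitmx.
Proof.
move=> kerE; rewrite -unitmx_tr -row_free_unit; apply: inj_row_free => v vE0.
apply: trmx_inj; rewrite trmx0; apply: kerE.
by rewrite -[E]trmxK -trmx_mul vE0 trmx0.
Qed.

Lemma quad_diag (R : realType) (n : nat) (d : 'rV[R]_n) (v : 'cV[R]_n) :
  (v^T *m diag_mx d *m v) 0 0 = \sum_i d 0 i * v i 0 ^+ 2.
Proof.
rewrite mxE; apply: eq_bigr => i _.
by rewrite mul_mx_diag !mxE -mulrA mulrCA expr2.
Qed.

Lemma quad_scalar (R : realType) (n : nat) (a : R) (v : 'cV[R]_n) :
  (v^T *m a%:M *m v) 0 0 = a * \sum_i v i 0 ^+ 2.
Proof.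
rewrite -diag_const_mx quad_diag mulr_sumr.
by apply: eq_bigr => i _; rewrite mxE.
Qed.

Lemma sumsq_eq0 (R : realType) (n : nat) (v : 'cV[R]_n) :
  \sum_i v i 0 ^+ 2 = 0 -> v = 0.
Proof.
move/eqP; rewrite psumr_eq0 => [/allP v0|i _]; last exact: sqr_ge0.
apply/colP => i; rewrite mxE; apply/eqP.
by rewrite -sqrf_eq0; apply: (v0 i); rewrite mem_index_enum.
Qed.

Lemma quad_scalar_gt0 (R : realType) (n : nat) (a : R) (v : 'cV[R]_n) :
  0 < a -> v != 0 -> 0 < (v^T *m a%:M *m v) 0 0.
Proof.
move=> a_gt0 v0; rewrite quad_scalar pmulr_rgt0 // lt_neqAle eq_sym.
rewrite sumr_ge0 ?andbT => [|i _]; last exact: sqr_ge0.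
by apply: contra_neq v0 => /sumsq_eq0.
Qed.

Lemma possemidef_diag (R : realType) (n : nat) (d : 'rV[R]_n) :
  (forall i, 0 <= d 0 i) -> possemidef (diag_mx d).
Proof.
move=> d_ge0 v; rewrite quad_diag; apply: sumr_ge0 => i _.
by rewrite mulr_ge0 ?sqr_ge0.
Qed.

Lemma quad_diag_eq0 (R : realType) (n : nat) (d : 'rV[R]_n) (v : 'cV[R]_n) :
  (forall i, 0 <= d 0 i) -> (v^T *m diag_mx d *m v) 0 0 = 0 ->
  diag_mx d *m v = 0.
Proof.
move=> d_ge0 /eqP; rewrite quad_diag psumr_eq0 => [/allP v0|i _]; last first.
  by rewrite mulr_ge0 ?sqr_ge0.
apply/colP => i; rewrite mul_diag_mx !mxE; apply/eqP.
by have := v0 i; rewrite mem_index_enum !mulf_eq0 orbb => /(_ isT).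
Qed.

Lemma possemidef_cong (R : realType) (m n : nat) (E : 'M[R]_m)
  (Q : 'M[R]_(m, n)) : possemidef E -> possemidef (Q^T *m E *m Q).
Proof.
by move=> E0 v; have := E0 (Q *m v); rewrite trmx_mul !mulmxA.
Qed.

Lemma possemidefD (R : realType) (n : nat) (E F : 'M[R]_n) :
  possemidef E -> possemidef F -> possemidef (E + F).
Proof.
by move=> E0 F0 v; rewrite mulmxDr mulmxDl mxE addr_ge0 ?E0 ?F0.
Qed.

Lemma possemidefZ (R : realType) (n : nat) (a : R) (E : 'M[R]_n) :
  0 <= a -> possemidef E -> possemidef (a *: E).
Proof.
by move=> a0 E0 v; rewrite -scalemxAr -scalemxAl mxE mulr_ge0 ?E0.
Qed.

Lemma possemidef_trace (R : realType) (n : nat) (E : 'M[R]_n) :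
  possemidef E -> 0 <= \tr E.
Proof.
move=> E0; apply: sumr_ge0 => i _; have := E0 (delta_mx i 0).
by rewrite trmx_delta -rowE -colE !mxE.
Qed.

Lemma posdef_cong (R : realType) (m n : nat) (E : 'M[R]_m) (Q : 'M[R]_(m, n)) :
  posdef E -> (forall v : 'cV[R]_n, Q *m v = 0 -> v = 0) ->
  posdef (Q^T *m E *m Q).
Proof.
move=> [E_sym E0] Qinj; split=> [|v v0]; first by rewrite !trmx_mul trmxK E_sym mulmxA.
have Qv0 : Q *m v != 0 by apply: contra_neq v0; apply: Qinj.
by have := E0 _ Qv0; rewrite trmx_mul !mulmxA.
Qed.

Lemma posdef_unit (R : realType) (n : nat) (E : 'M[R]_n) :
  posdef E -> E \in unitmx.
Proof.
move=> [_ E0]; apply: unitmx_ker0 => v Ev0; apply/eqP; apply/negPn/negP => v0.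
by have := E0 _ v0; rewrite -mulmxA Ev0 mulmx0 mxE ltxx.
Qed.

(** One step of symmetric Gaussian elimination: [P] is unit lower triangular and [S] is the Schur
    complement of the corner [a]. It drives the inductions on size for the log-determinant bound and
    for whitening. *)
Lemma posdef_schur (R : realType) (n : nat) (E : 'M[R]_(1 + n)) :
  posdef E ->
  exists (P : 'M[R]_(1 + n)) (a : R) (S : 'M[R]_n),
    [/\ \det P = 1, P *m E *m P^T = block_mx a%:M 0 0 S, 0 < a,
        posdef S & a + \tr S <= \tr E].
Proof.
move=> Epos; have [E_sym E0] := Epos.
pose a := E 0 0; pose b := ursubmx E; pose C := drsubmx E.
have defE : E = block_mx a%:M b b^T C.
  have /= := submxK E; rewrite [ulsubmx E]mx11_scalar !mxE.
  have -> : dlsubmx E = b^T by rewrite /b trmx_ursub E_sym.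
  have -> : lshift n (0 : 'I_1) = 0 :> 'I_(1 + n) by apply: val_inj.
  by move->.
have a_gt0 : 0 < a.
  have e0 : delta_mx 0 0 != 0 :> 'cV[R]_(1 + n).
    by apply/eqP => /matrixP /(_ 0 0) /eqP; rewrite !mxE !eqxx oner_eq0.
  by have := E0 _ e0; rewrite trmx_delta -rowE -colE !mxE.
have a0 : a != 0 by rewrite gt_eqF.
pose S := C - a^-1 *: (b^T *m b).
exists (block_mx 1%:M 0 (- a^-1 *: b^T) 1%:M), a, S; split => //.
- by rewrite det_lblock !det1 mulr1.
- rewrite defE tr_block_mx !mulmx_block !trmx1 !trmx0 !linearZ /= trmxK.
  rewrite !mul1mx !mulmx1 !mul0mx !mulmx0 !addr0.
  rewrite mul_scalar_mx mul_mx_scalar !scalerA mulrN mulNr mulfV ?mulVf // !scaleN1r.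
  by rewrite !addNr mul0mx scaler0 add0r /S scaleNr mulNmx -scalemxAl addrC.
(* The Schur complement is a congruence of [E] by a block column that is injective because its lower
   block is the identity. *)
- have -> : S = (col_mx (- a^-1 *: b) 1%:M)^T *m E *m col_mx (- a^-1 *: b) 1%:M.
    rewrite defE tr_col_mx mul_row_block mul_row_col !trmx1 !linearZ /=.
    rewrite !mul1mx !mulmx1 mul_mx_scalar !scalerA mulrN mulfV // scaleN1r.
    by rewrite addNr mul0mx scaler0 add0r /S scaleNr mulNmx -scalemxAl addrC.
  apply: posdef_cong => // v; rewrite mul_col_mx mul1mx => /eqP.
  by rewrite col_mx_eq0 => /andP[_ /eqP].
(* Passing from [C] to [S] removes a nonnegative multiple of the Gram matrix [b^T *m b], so the
   trace can only drop. *)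
- rewrite [in leRHS]defE mxtrace_block mxtrace_scalar mulr1n lerD2l.
  rewrite /S raddfB /= linearZ /= gerBl mulr_ge0 ?invr_ge0 ?(ltW a_gt0) //.
  rewrite possemidef_trace // => v.
  have := possemidef_cong (R := R) (E := 1%:M) b.
  rewrite mulmx1; apply => w; rewrite quad_scalar mul1r.
  by apply: sumr_ge0 => i _; rewrite sqr_ge0.
Qed.

(** * Log-determinant and trace inequalities *)

Lemma det_congruent (R : realType) (n : nat) (P E : 'M[R]_n) :
  \det (P *m E *m P^T) = \det P ^+ 2 * \det E.
Proof. by rewrite !det_mulmx det_tr mulrAC expr2. Qed.

(** Each pivot satisfies [ln a <= a - 1]; elimination multiplies the pivots into the determinant,
    while their sum stays below the trace. *)
Lemma posdef_ln_det_le (R : realType) (n : nat) (E : 'M[R]_n) :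
  posdef E -> 0 < \det E /\ ln (\det E) <= \tr E - n%:R.
Proof.
elim: n E => [|n IHn] E Epos.
  by rewrite det_mx00 ln1 subr0 /mxtrace big_ord0.
have [P [a [S [detP PE a_gt0 /IHn[S_gt0 lnS] trS]]]] := posdef_schur Epos.
have -> : \det E = a * \det S.
  by rewrite -[LHS]mul1r -(expr1n _ 2) -detP -det_congruent PE det_ublock det_scalar1.
split; first exact: mulr_gt0.
rewrite lnM ?posrE // -natr1.
have := @le_ln1Dx R (a - 1); rewrite [1 + _]addrC subrK => lna.
have := lna _; rewrite ltrBrDr addNr => /(_ a_gt0).
move: trS lnS; move: (\tr E) (\tr S) (ln (\det S)) (ln a) n%:R => *; lra.
Qed.

(** An inverse Cholesky factor, found by eliminating, rescaling the pivot and recursing on the Schur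
    complement. *)
Lemma posdef_whiten (R : realType) (n : nat) (E : 'M[R]_n) :
  posdef E ->
  exists P : 'M[R]_n, [/\ P \in unitmx, P *m E *m P^T = 1%:M & invmx E = P^T *m P].
Proof.
move=> Epos; have Eu := posdef_unit Epos.
suff [P PE] : exists P : 'M[R]_n, P *m E *m P^T = 1%:M.
  have Pu : P \in unitmx.
    by have /mulmx1_unit[] : P *m (E *m P^T) = 1%:M by rewrite mulmxA.
  exists P; split=> //; apply: (can_inj (mulKmx Eu)); rewrite mulmxV //.
  by apply: (can_inj (mulKmx Pu)); rewrite !mulmxA PE mul1mx mulmx1.
elim: n E Epos {Eu} => [|n IHn] E Epos; first by exists 0; apply/matrixP => -[].
have [P [a [S [_ PE a_gt0 /IHn[Q QS] _]]]] := posdef_schur Epos.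
(* Chosen so that [c * a * c = 1]. *)
pose c := Num.sqrt a^-1.
pose T : 'M[R]_(1 + n) := block_mx c%:M 0 0 Q.
have TT : T *m block_mx a%:M 0 0 S *m T^T = 1%:M.
  rewrite tr_block_mx !mulmx_block !trmx0 !mul0mx !mulmx0 !addr0 !add0r QS.
  rewrite !mul0mx tr_scalar_mx -!scalar_mxM mulrAC -expr2 sqr_sqrtr ?invr_ge0 ?ltW //.
  by rewrite mulVf ?gt_eqF // -scalar_mx_block.
by exists (T *m P); rewrite -TT -PE trmx_mul !mulmxA.
Qed.

(** Whitening [E] reduces this to the bound for [P *m F *m P^T], whose determinant is
    [\det F / \det E] and whose trace is that of [invmx E *m F] by cyclicity. *)
Lemma ln_det_le_trace (R : realType) (n : nat) (E F : 'M[R]_n) :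
  posdef E -> posdef F ->
  ln (\det F) <= ln (\det E) + (\tr (invmx E *m F) - n%:R).
Proof.
move=> Epos Fpos; have [P [Pu PE invE]] := posdef_whiten Epos.
have [E_gt0 _] := posdef_ln_det_le Epos.
have [F_gt0 _] := posdef_ln_det_le Fpos.
have detPE : \det P ^+ 2 * \det E = 1 by rewrite -det_congruent PE det1.
have PFpos : posdef (P *m F *m P^T).
  rewrite -[X in X *m F]trmxK; apply: posdef_cong => // v Pv0.
  by rewrite -[v]mul1mx -(mulVmx (_ : P^T \in unitmx)) ?unitmx_tr // -mulmxA Pv0 mulmx0.
have [_] := posdef_ln_det_le PFpos.
have -> : \tr (P *m F *m P^T) = \tr (invmx E *m F).
  by rewrite mxtrace_mulC mulmxA invE.
rewrite det_congruent; have -> : \det P ^+ 2 = (\det E)^-1.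
  by apply: (mulIf (lt0r_neq0 E_gt0)); rewrite detPE mulVf ?gt_eqF.
by rewrite lnM ?posrE ?invr_gt0 // lnV ?posrE // addrC lerBlDr addrC.
Qed.

Lemma trace_inv_posdef_ge0 (R : realType) (n : nat) (E F : 'M[R]_n) :
  posdef E -> possemidef F -> 0 <= \tr (invmx E *m F).
Proof.
move=> Epos F0; have [P [_ _ ->]] := posdef_whiten Epos.
rewrite -mulmxA mxtrace_mulC -[X in X *m F]trmxK.
exact: possemidef_trace (possemidef_cong _ F0).
Qed.

(** Used to turn the trace of the tangent term into a weighted sum of the values of [psi]. *)
Lemma mxtrace_diag_cong (R : comPzRingType) (m n : nat) (E : 'M[R]_n)
  (d : 'rV[R]_m) (V : 'M[R]_(m, n)) :
  \tr (E *m (V^T *m diag_mx d *m V)) = \sum_j d 0 j * (V *m E *m V^T) j j.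
Proof.
rewrite mulmxA mxtrace_mulC !mulmxA mxtrace_mulC mul_diag_mx.
by apply: eq_bigr => j _; rewrite mxE.
Qed.

(** * The information matrix as a function of the design *)

Definition nneg_row (R : realType) (n : nat) (xi : 'rV[R]_n) : Prop :=
  forall j, 0 <= xi 0 j.

(** A square-root-free stand-in for the matrix inverted in [Mbeta]: with [S = M0sqrt xi] and [xi]
    nonnegative, [S *m cov_mx s2 Sg xi] equals [(s2%:M + S *m Sg *m S) *m S]. *)
Definition cov_mx (R : realType) (J : nat) (s2 : R) (Sg : 'M[R]_J)
  (xi : 'rV[R]_J) : 'M[R]_J := s2%:M + Sg *m M0 xi.

(* The unique W with s2 W + Sg M0(xi) W = A. *)
Definition resp_mx (R : realType) (J p : nat) (s2 : R) (Sg : 'M[R]_J)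
  (A : 'M[R]_(J, p)) (xi : 'rV[R]_J) : 'M[R]_(J, p) :=
  invmx (cov_mx s2 Sg xi) *m A.

Section Information.
Variables (R : realType) (J p : nat) (s2 : R) (Sg : 'M[R]_J) (A : 'M[R]_(J, p)).
Hypotheses (s2_gt0 : 0 < s2) (Sg_sym : Sg^T = Sg) (Sg_ge0 : possemidef Sg).

Implicit Types xi : 'rV[R]_J.

Local Notation K := (cov_mx s2 Sg).
Local Notation W := (resp_mx s2 Sg A).

(** With [D = M0 xi], the form splits as [s2 * w^T D w] plus the form of [Sg] at [D w]; both are
    nonnegative, so the first one vanishes. *)
Lemma quad_cov_mx_eq0 xi (w : 'cV[R]_J) :
  nneg_row xi ->
  (w^T *m M0 xi *m K xi *m w) 0 0 = 0 -> M0 xi *m w = 0.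
Proof.
move=> xi0; rewrite /cov_mx mulmxDr mulmxDl mxE mul_mx_scalar -scalemxAl mxE => sum0.
apply: quad_diag_eq0 => //.
have q1 : 0 <= (w^T *m M0 xi *m w) 0 0 by exact: possemidef_diag.
have q2 : 0 <= (w^T *m M0 xi *m (Sg *m M0 xi) *m w) 0 0.
  have := Sg_ge0 (M0 xi *m w); rewrite trmx_mul tr_diag_mx.
  by rewrite !mulmxA.
have /eqP := sum0; rewrite paddr_eq0 ?mulr_ge0 ?(ltW s2_gt0) //.
by rewrite mulf_eq0 gt_eqF //= => /andP[/eqP].
Qed.

Lemma cov_mx_unit xi : nneg_row xi -> K xi \in unitmx.
Proof.
move=> xi0; apply: unitmx_ker0 => w Kw0.
have Dw0 : M0 xi *m w = 0.
  by apply: quad_cov_mx_eq0 => //; rewrite -mulmxA Kw0 mulmx0 mxE.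
move/eqP: Kw0; rewrite mulmxDl -mulmxA Dw0 mulmx0 addr0 mul_scalar_mx.
by rewrite scaler_eq0 gt_eqF //= => /eqP.
Qed.

Lemma tr_cov_mx xi : (K xi)^T = s2%:M + M0 xi *m Sg.
Proof. by rewrite linearD /= trmx_mul tr_scalar_mx tr_diag_mx Sg_sym. Qed.

Lemma resp_mxP xi : nneg_row xi -> s2 *: W xi + Sg *m (M0 xi *m W xi) = A.
Proof.
move=> xi0; rewrite -mul_scalar_mx mulmxA -mulmxDl.
by rewrite /resp_mx mulmxA mulmxV ?cov_mx_unit // mul1mx.
Qed.

Lemma M0sqrt_sqr xi : nneg_row xi -> M0sqrt xi *m M0sqrt xi = M0 xi.
Proof.
move=> xi0; rewrite /M0sqrt mulmx_diag; congr diag_mx.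
by apply/rowP => j; rewrite !mxE -expr2 sqr_sqrtr.
Qed.

Lemma sym_cov_mx_unit xi :
  s2%:M + M0sqrt xi *m Sg *m M0sqrt xi \in unitmx.
Proof.
apply: unitmx_ker0 => w; set S := M0sqrt xi; set X := s2%:M + _ => Xw0.
have S_tr : S^T = S by rewrite /S /M0sqrt tr_diag_mx.
apply/eqP; apply/negPn/negP => w0.
have q1 := quad_scalar_gt0 s2_gt0 w0.
have q2 := Sg_ge0 (S *m w).
have : (w^T *m X *m w) 0 0 = 0 by rewrite -mulmxA Xw0 mulmx0 mxE.
rewrite mulmxDr mulmxDl mxE; apply/eqP; rewrite gt_eqF // ltr_wpDr //.
by move: q2; rewrite trmx_mul S_tr !mulmxA.
Qed.

(** The relation [S *m A = X *m (S *m W xi)] cancels the inner inverse, and the two remaining square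
    roots multiply to [M0 xi]. *)
Lemma Mbeta_AW xi : nneg_row xi -> Mbeta s2 Sg A xi = A^T *m (M0 xi *m W xi).
Proof.
move=> xi0; rewrite /Mbeta; set S := M0sqrt xi; set X := s2%:M + _.
have Xu : X \in unitmx by exact: sym_cov_mx_unit.
have SA : S *m A = X *m (S *m W xi).
  rewrite -[in LHS](resp_mxP xi0) mulmxDr -scalemxAr mulmxDl mul_scalar_mx.
  by rewrite -(M0sqrt_sqr xi0) !mulmxA.
rewrite -!mulmxA SA (mulmxA (invmx X)) mulVmx // mul1mx.
by rewrite (mulmxA S) M0sqrt_sqr.
Qed.

(** Substituting [A = s2 W + Sg D W] for the left factor of [A^T D W] exhibits two positive
    semidefinite terms. *)
Lemma Mbeta_W xi : nneg_row xi ->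
  Mbeta s2 Sg A xi =
  s2 *: ((W xi)^T *m M0 xi *m W xi)
  + (M0 xi *m W xi)^T *m Sg *m (M0 xi *m W xi).
Proof.
move=> xi0; rewrite Mbeta_AW // -[in A^T](resp_mxP xi0) linearD linearZ /=.
by rewrite (trmx_mul Sg) Sg_sym mulmxDl -scalemxAl !mulmxA.
Qed.

Lemma Mbeta_sym xi : nneg_row xi -> (Mbeta s2 Sg A xi)^T = Mbeta s2 Sg A xi.
Proof.
move=> xi0; rewrite Mbeta_W //; move: (W xi) => V.
by rewrite linearD linearZ /= !trmx_mul !trmxK Sg_sym tr_diag_mx !mulmxA.
Qed.

(** If the form vanishes at [v], then [w = W xi *m v] satisfies [M0 xi *m w = 0], hence
    [s2 *: w = A *m v]. The column space condition makes [w] orthogonal to the columns of [A], so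
    [w = 0], and full column rank gives [v = 0]. *)
Lemma Mbeta_posdef xi : nneg_row xi -> estimable A xi ->
  posdef (Mbeta s2 Sg A xi).
Proof.
move=> xi0 [rkA /submxP[B AB]]; split; first exact: Mbeta_sym.
have defA : A = M0 xi *m B^T.
  by apply: trmx_inj; rewrite AB trmx_mul trmxK.
move=> v v0.
pose w := W xi *m v.
have Kw : K xi *m w = A *m v by rewrite /w /resp_mx !mulmxA mulmxV ?cov_mx_unit // mul1mx.
have quadE : (v^T *m Mbeta s2 Sg A xi *m v) 0 0
    = s2 * (w^T *m M0 xi *m w) 0 0 + ((M0 xi *m w)^T *m Sg *m (M0 xi *m w)) 0 0.
  rewrite Mbeta_W // mulmxDr mulmxDl mxE -scalemxAr -scalemxAl mxE.
  by rewrite /w; move: (W xi) => V; rewrite !trmx_mul !mulmxA.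
have q1 : 0 <= (w^T *m M0 xi *m w) 0 0 by exact: possemidef_diag.
rewrite lt_neqAle quadE addr_ge0 ?mulr_ge0 ?(ltW s2_gt0) // andbT eq_sym.
apply: contra_neq v0 => /eqP; rewrite paddr_eq0 ?mulr_ge0 ?(ltW s2_gt0) //.
rewrite mulf_eq0 gt_eqF //= => /andP[/eqP/(quad_diag_eq0 xi0) Dw0 _].
have sw : s2 *: w = A *m v.
  by rewrite -Kw mulmxDl mul_scalar_mx -mulmxA Dw0 mulmx0 addr0.
have w0 : w = 0.
  apply: sumsq_eq0; have := congr1 (fun X => (w^T *m X) 0 0) sw.
  rewrite -mul_scalar_mx mulmxA quad_scalar defA !mulmxA.
  have -> : w^T *m M0 xi = 0 by rewrite -[M0 xi]tr_diag_mx -trmx_mul Dw0 trmx0.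
  by rewrite !mul0mx mxE => /eqP; rewrite mulf_eq0 gt_eqF //= => /eqP.
have Av0 : A *m v = 0 by rewrite -sw w0 scaler0.
have rfA : row_free A^T by rewrite /row_free mxrank_tr rkA.
apply: trmx_inj; apply: (row_free_inj rfA).
by rewrite -trmx_mul Av0 !trmx0 mul0mx.
Qed.

(* The right-hand side is positive semidefinite, so this is the concavity of
   Mbeta in the design. *)
Lemma Mbeta_tangent_gap xi xi' : nneg_row xi -> nneg_row xi' ->
  Mbeta s2 Sg A xi + s2 *: ((W xi)^T *m (M0 xi' - M0 xi) *m W xi)
    - Mbeta s2 Sg A xi'
  = s2 *: ((W xi - W xi')^T *m M0 xi' *m (W xi - W xi'))
    + (M0 xi *m W xi - M0 xi' *m W xi')^T *m Sg
        *m (M0 xi *m W xi - M0 xi' *m W xi').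
Proof.
move=> xi0 xi0'; rewrite !Mbeta_W //.
(* Both designs recover the same [A], so [s2 V + Sg U = s2 V' + Sg U']. Multiplying by [U'^T], and
   transposing the result, gives the two relations [e1] and [e2] that absorb all cross terms; the
   rest is linear in each entry. *)
have := etrans (resp_mxP xi0) (esym (resp_mxP xi0')).
have D_tr : (M0 xi')^T = M0 xi' by rewrite tr_diag_mx.
move: (M0 xi) (M0 xi') (W xi) (W xi') D_tr => D D' V V' D_tr.
have U'_tr : (D' *m V')^T = V'^T *m D' by rewrite trmx_mul D_tr.
move defU' : (D' *m V') U'_tr => U' U'_tr; move: (D *m V) => U eqA.
have e1 := congr1 (mulmx U'^T) eqA.
have e2 := congr1 trmx e1.
rewrite !trmx_mul !trmxK !linearD !linearZ /= !trmx_mul Sg_sym in e2.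
rewrite !mulmxDr -!scalemxAr in e1; rewrite !mulmxDl -!scalemxAl in e2.
have D'V' X : X *m D' *m V' = X *m U' :> 'M[R]_p by rewrite -mulmxA defU'.
have QE : U'^T *m V' = V'^T *m U' by rewrite U'_tr D'V'.
rewrite !(linearB, linearD) /= !(mulmxBr, mulmxBl, mulmxDr, mulmxDl) !D'V' -U'_tr.
rewrite !mulmxA !QE in e1 e2 *.
apply/matrixP => i j; move/matrixP/(_ i j): e1; move/matrixP/(_ i j): e2.
move: (V'^T *m U') (U'^T *m V) (V^T *m U') (V^T *m D *m V) (V^T *m D' *m V).
move: (U^T *m Sg *m U) (U^T *m Sg *m U') (U'^T *m Sg *m U) (U'^T *m Sg *m U').
move=> S1 S2 S3 S4 Q1 Q2 Q3 Q4 Q5; rewrite !mxE => e2 e1; lra.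
Qed.

Lemma psiE xi j :
  psi s2 Sg A xi j = (W xi *m invmx (Mbeta s2 Sg A xi) *m (W xi)^T) j j.
Proof. by rewrite /psi -tr_cov_mx -trmx_inv -[_ *m A^T *m _]mulmxA -trmx_mul. Qed.

(** The tangent at [xi] dominates [Mbeta] at [xi'], and pairing with the inverse of [Mbeta] at [xi]
    keeps this order under the trace; the term [p] from the trace of the identity cancels. *)
Lemma ln_det_Mbeta_le xi xi' :
  nneg_row xi -> nneg_row xi' -> estimable A xi -> estimable A xi' ->
  ln (\det (Mbeta s2 Sg A xi')) <= ln (\det (Mbeta s2 Sg A xi))
    + s2 * \sum_j (xi' 0 j - xi 0 j) * psi s2 Sg A xi j.
Proof.
move=> xi0 xi0' Axi Axi'.
have Mpos := Mbeta_posdef xi0 Axi.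
apply: le_trans (ln_det_le_trace Mpos (Mbeta_posdef xi0' Axi')) _.
rewrite lerD2l; set M := Mbeta _ _ _ xi; set M' := Mbeta _ _ _ xi'.
have -> : s2 * \sum_j (xi' 0 j - xi 0 j) * psi s2 Sg A xi j =
    \tr (invmx M *m (s2 *: ((W xi)^T *m (M0 xi' - M0 xi) *m W xi))).
  rewrite -scalemxAr linearZ /=; congr (_ * _).
  rewrite /M0 -linearB /= mxtrace_diag_cong.
  by apply: eq_bigr => j _; rewrite psiE !mxE.
set X := s2 *: _.
have gap_ge0 : possemidef (M + X - M').
  rewrite Mbeta_tangent_gap //; apply: possemidefD; last exact: possemidef_cong.
  by apply: possemidefZ (ltW s2_gt0) _; apply/possemidef_cong/possemidef_diag.
have := trace_inv_posdef_ge0 Mpos gap_ge0.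
rewrite !mulmxDr mulmxN mulVmx ?posdef_unit // !mxtraceD raddfN /= mxtrace1.
by rewrite subr_ge0 lerBlDl.
Qed.

End Information.

(** * Entrywise limits of matrices and continuity of [psi] *)

Section Limits.
Local Open Scope classical_set_scope.
Variables (R : realType) (T : Type) (F : set_system T) (FF : Filter F).

Definition cvgmx m n (f : T -> 'M[R]_(m, n)) (l : 'M[R]_(m, n)) : Prop :=
  forall i j, f x i j @[x --> F] --> l i j.

Lemma cvgmx_mul m n q (f : T -> 'M[R]_(m, n)) (g : T -> 'M[R]_(n, q)) k l :
  cvgmx f k -> cvgmx g l -> cvgmx (fun x => f x *m g x) (k *m l).
Proof.
move=> fk gl i j; rewrite mxE; under eq_cvg do rewrite mxE.
apply: cvg_big => [|h _]; first exact: add_continuous.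
exact: cvgM.
Qed.

Lemma cvgmx_det n (f : T -> 'M[R]_n) k :
  cvgmx f k -> \det (f x) @[x --> F] --> \det k.
Proof.
move=> fk; apply: cvg_big => [|s _]; first exact: add_continuous.
apply: cvgM; first exact: cvg_cst.
by apply: cvg_big => [|i _]; [exact: mul_continuous|exact: fk].
Qed.

Lemma cvgmx_inv n (f : T -> 'M[R]_n) k :
  k \in unitmx -> cvgmx f k -> cvgmx (fun x => invmx (f x)) (invmx k).
Proof.
move=> ku fk i j; have detk : \det k != 0 by rewrite -unitfE.
have detf := cvgmx_det fk.
rewrite /invmx ku !mxE.
(* Off the units [invmx] returns its argument, so the adjugate formula holds only eventually, once
   the determinant is nonzero. *)
apply: cvg_trans (_ : (\det (f x))^-1 * cofactor (f x) j i @[x --> F] --> _).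
  apply: near_eq_cvg; near=> x.
  have -> : f x \in unitmx by rewrite unitmxE unitfE; near: x; exact: cvgr_neq0 detk.
  by rewrite !mxE.
apply: cvgM; first exact: cvgV.
apply: cvgM; first exact: cvg_cst.
apply: cvgmx_det => a b; rewrite !mxE; under eq_cvg do rewrite !mxE.
exact: fk.
Unshelve. all: by end_near. Qed.

Lemma cvgmx_add m n (f g : T -> 'M[R]_(m, n)) k l :
  cvgmx f k -> cvgmx g l -> cvgmx (fun x => f x + g x) (k + l).
Proof.
move=> fk gl i j; rewrite mxE; under eq_cvg do rewrite mxE.
exact: cvgD.
Qed.

Lemma cvgmx_cst m n (k : 'M[R]_(m, n)) : cvgmx (fun=> k) k.
Proof. by move=> i j; exact: cvg_cst. Qed.

Lemma cvgmx_diag n (f : T -> 'rV[R]_n) k :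
  cvgmx f k -> cvgmx (fun x => diag_mx (f x)) (diag_mx k).
Proof.
move=> fk i j; rewrite mxE; under eq_cvg do rewrite mxE.
by case: (i == j); [exact: fk | exact: cvg_cst].
Qed.

Lemma cvgmx_sqrt m n (f : T -> 'M[R]_(m, n)) k :
  cvgmx f k -> cvgmx (fun x => map_mx Num.sqrt (f x)) (map_mx Num.sqrt k).
Proof.
move=> fk i j; rewrite mxE; under eq_cvg do rewrite mxE.
exact: (continuous_cvg _ (@sqrt_continuous R _) (fk i j)).
Qed.

Lemma cvg_psi (J p : nat) (s2 : R) (Sg : 'M[R]_J) (A : 'M[R]_(J, p))
  (f : T -> 'rV[R]_J) (xi : 'rV[R]_J) (j : 'I_J) :
  0 < s2 -> Sg^T = Sg -> possemidef Sg -> nneg_row xi -> estimable A xi ->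
  cvgmx f xi -> psi s2 Sg A (f x) j @[x --> F] --> psi s2 Sg A xi j.
Proof.
move=> s2_gt0 Sg_sym Sg_ge0 xi0 Axi f_xi.
have cvgD0 : cvgmx (fun x => M0 (f x)) (M0 xi) by exact: cvgmx_diag.
have cvgS : cvgmx (fun x => M0sqrt (f x)) (M0sqrt xi).
  by apply: cvgmx_diag; exact: cvgmx_sqrt.
have Ku := cov_mx_unit s2_gt0 Sg_ge0 xi0.
have Ktu : s2%:M + M0 xi *m Sg \in unitmx.
  by rewrite -(tr_cov_mx s2 Sg_sym) unitmx_tr.
have Mu := posdef_unit (Mbeta_posdef s2_gt0 Sg_sym Sg_ge0 xi0 Axi).
have Xu := sym_cov_mx_unit s2_gt0 Sg_ge0 xi.
have cst m n (k : 'M[R]_(m, n)) : cvgmx (fun=> k) k by exact: cvgmx_cst.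
have cvgMb : cvgmx (fun x => Mbeta s2 Sg A (f x)) (Mbeta s2 Sg A xi).
  do 2![apply: cvgmx_mul => //]; apply: cvgmx_mul; first exact: cvgmx_mul.
  by apply: cvgmx_inv => //; apply: cvgmx_add => //; do 2![apply: cvgmx_mul => //].
suff : cvgmx (fun x => invmx (s2%:M + Sg *m M0 (f x)) *m A
    *m invmx (Mbeta s2 Sg A (f x)) *m A^T *m invmx (s2%:M + M0 (f x) *m Sg))
  (invmx (s2%:M + Sg *m M0 xi) *m A
    *m invmx (Mbeta s2 Sg A xi) *m A^T *m invmx (s2%:M + M0 xi *m Sg)) by apply.
apply: cvgmx_mul; first apply: cvgmx_mul => //; first apply: cvgmx_mul.
- apply: cvgmx_mul => //; apply: cvgmx_inv => //.
  by apply: cvgmx_add => //; exact: cvgmx_mul.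
- exact: cvgmx_inv.
- by apply: cvgmx_inv => //; apply: cvgmx_add => //; exact: cvgmx_mul.
Qed.

End Limits.

(** * Mixtures with one-point designs and the equivalence theorem *)

Lemma estimable_support (R : realType) (J p : nat) (A : 'M[R]_(J, p))
  (xi xi' : 'rV[R]_J) :
  (forall j, xi 0 j != 0 -> xi' 0 j != 0) -> estimable A xi -> estimable A xi'.
Proof.
move=> supp [rkA subA]; split=> //; apply: submx_trans subA _.
rewrite /M0 !tr_diag_mx; apply/submxP.
(* The ratios rescale [xi'] to [xi]; where [xi] vanishes, so does the ratio, whatever [xi'] is. *)
exists (diag_mx (\row_j (xi 0 j / xi' 0 j))).
rewrite mulmx_diag; congr diag_mx; apply/rowP => j; rewrite !mxE.
by have [->|/supp xi'0] := eqVneq (xi 0 j) 0; rewrite ?mul0r ?divfK.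
Qed.

Lemma is_design_mix (R : realType) (J : nat) (I e : R) (xi : 'rV[R]_J) (k : 'I_J) :
  0 < I -> 0 <= e <= 1 -> is_design I xi ->
  is_design I ((1 - e) *: xi + (e * I) *: delta_mx 0 k).
Proof.
move=> I_gt0 /andP[e0 e1] [xi0 xiI]; split=> [j|].
  by rewrite !mxE addr_ge0 // mulr_ge0 ?subr_ge0 ?mulr_ge0 ?ler0n ?(ltW I_gt0).
under eq_bigr do rewrite !mxE eqxx /=.
rewrite big_split /= -!mulr_sumr xiI (bigD1 k) //= eqxx big1 => [|j /negPf ->//].
by rewrite addr0 mulr1 mulrBl mul1r subrK.
Qed.

Lemma D_optimal_psi_le (R : realType) (J p : nat) (s2 : R) (Sg : 'M[R]_J)
  (I : R) (A : 'M[R]_(J, p)) (xis : 'rV[R]_J) (k : 'I_J) :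
  0 < s2 -> Sg^T = Sg -> possemidef Sg -> 0 < I ->
  is_design I xis -> estimable A xis -> locally_D_optimal I s2 Sg A xis ->
  I * psi s2 Sg A xis k <= \sum_j xis 0 j * psi s2 Sg A xis j.
Proof.
move=> s2_gt0 Sg_sym Sg_ge0 I_gt0 des est opt.
pose f e : 'rV[R]_J := (1 - e) *: xis + (e * I) *: delta_mx 0 k.
have f_le e : 0 < e < 1 ->
    I * psi s2 Sg A (f e) k - \sum_j xis 0 j * psi s2 Sg A (f e) j <= 0.
  move=> /andP[e0 e1].
  have fdes : is_design I (f e).
    by apply: is_design_mix; rewrite ?(ltW e0) ?(ltW e1).
  (* As [e < 1], every support point of [xis] keeps positive weight in the mixture. *)
  have fest : estimable A (f e).
    apply: estimable_support est => j xij0.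
    rewrite gt_eqF // !mxE ltr_wpDr ?mulr_ge0 ?ler0n ?(ltW e0) ?(ltW I_gt0) //.
    by rewrite mulr_gt0 ?subr_gt0 // lt_neqAle eq_sym xij0 des.1.
  (* Optimality bounds the log-determinant at [f e] by that at [xis], which leaves a nonnegative
     linear term; since [xis - f e] is [e] times [xis - I delta_k], the positive factors [s2] and
     [e] divide out. *)
  have := ln_det_Mbeta_le s2_gt0 Sg_sym Sg_ge0 fdes.1 des.1 fest est.
  move=> /le_trans /(_ (lerD (opt _ fdes fest) (lexx _))).
  rewrite -subr_ge0 addrAC subrr add0r pmulr_rge0 //.
  have -> : \sum_j (xis 0 j - f e 0 j) * psi s2 Sg A (f e) j =
    e * (\sum_j xis 0 j * psi s2 Sg A (f e) j - I * psi s2 Sg A (f e) k).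
    have -> : I * psi s2 Sg A (f e) k =
        \sum_j (I * (j == k)%:R) * psi s2 Sg A (f e) j.
      rewrite (bigD1 k) //= eqxx mulr1 big1 ?addr0 // => j /negPf ->.
      by rewrite mulr0 mul0r.
    rewrite -sumrB mulr_sumr; apply: eq_bigr => j _.
    by rewrite !mxE eqxx /=; ring.
  by rewrite pmulr_rge0 // subr_ge0 -subr_le0.
have f0 : f 0 = xis by rewrite /f subr0 scale1r mul0r scale0r addr0.
(* The inequality is known only for [0 < e < 1], hence the right-sided limit at 0. *)
have cvg_f : cvgmx (0 : R)^'+%classic f xis.
  rewrite -f0 => i j; apply: cvg_at_right_filter.
  rewrite /f !mxE; under eq_cvg do rewrite !mxE.
  apply: cvgD; apply: cvgM; try exact: cvg_cst.
    by apply: cvgB; [exact: cvg_cst|exact: cvg_id].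
  by apply: cvgM; [exact: cvg_id|exact: cvg_cst].
rewrite -subr_le0.
apply: (@cvgr_to_le _ (0 : R)^'+%classic _ _ (fun e =>
    I * psi s2 Sg A (f e) k - \sum_j xis 0 j * psi s2 Sg A (f e) j)); last first.
  near=> e; apply: f_le; apply/andP; split; near: e.
    exact: nbhs_right_gt.
  exact: nbhs_right_lt.
have cvg_psi_f j := cvg_psi j s2_gt0 Sg_sym Sg_ge0 des.1 est cvg_f.
apply: cvgB; first by apply: cvgM; [exact: cvg_cst|exact: cvg_psi_f].
apply: cvg_big => [|j _]; first exact: add_continuous.
by apply: cvgM; [exact: cvg_cst|exact: cvg_psi_f].
Unshelve. all: by end_near. Qed.

Theorem theorem1 (R : realType) (J p : nat) (s2 : R) (Sg : 'M[R]_J)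
  (I : R) (A : 'M[R]_(J, p)) (xis : 'rV[R]_J) :
  (1 <= p)%N -> (p <= J)%N -> 0 < s2 ->
  Sg^T = Sg -> (forall v : 'cV[R]_J, 0 <= (v^T *m Sg *m v) 0 0) ->
  0 < I ->
  is_design I xis -> estimable A xis ->
  (locally_D_optimal I s2 Sg A xis <->
     (forall j : 'I_J, psi s2 Sg A xis j
        <= I^-1 * \sum_(l < J) xis 0 l * psi s2 Sg A xis l)) /\
  (locally_D_optimal I s2 Sg A xis ->
     forall j : 'I_J, 0 < xis 0 j ->
       psi s2 Sg A xis j = I^-1 * \sum_(l < J) xis 0 l * psi s2 Sg A xis l).
Proof.
move=> _ _ s2_gt0 Sg_sym Sg_ge0 I_gt0 des est.
set c := I^-1 * _.
have Ic : I * c = \sum_(l < J) xis 0 l * psi s2 Sg A xis l.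
  by rewrite mulrA mulfV ?mul1r ?gt_eqF.
have opt_le : locally_D_optimal I s2 Sg A xis -> forall j, psi s2 Sg A xis j <= c.
  by move=> opt j; rewrite -(ler_pM2l I_gt0) Ic; exact: D_optimal_psi_le.
split; first split=> // psi_le xi xi_des xi_est.
- have := ln_det_Mbeta_le s2_gt0 Sg_sym Sg_ge0 des.1 xi_des.1 est xi_est.
  move=> /le_trans; apply; rewrite gerDl pmulr_rle0 //.
  (* The linear term is the sum of [xi_j psi_j] minus [I * c]; since [xi] has total [I], it is at
     most 0 when every [psi_j] is at most [c]. *)
  under eq_bigr do rewrite mulrBl.
  rewrite sumrB -Ic subr_le0 -xi_des.2 mulr_suml.
  by apply: ler_sum => j _; rewrite ler_wpM2l ?psi_le ?xi_des.1.
- move=> /opt_le psi_le j xij.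
  (* The slacks [c - psi_l] are nonnegative and their sum weighted by [xis] is [I * c - I * c], so
     each slack with positive weight vanishes. *)
  have /eqP : \sum_l xis 0 l * (c - psi s2 Sg A xis l) = 0.
    under eq_bigr do rewrite mulrBr.
    by rewrite sumrB -Ic -mulr_suml des.2 subrr.
  rewrite psumr_eq0 => [/allP /(_ j)|l _]; last by rewrite mulr_ge0 ?des.1 ?subr_ge0.
  by rewrite mem_index_enum mulf_eq0 gt_eqF //= subr_eq0 => /(_ isT) /eqP.
Qed.
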